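(* Let $n\ge 2$, let $\mathbb{X}$ be a finite set of $s$ distinct points in $\mathbb{P}^n_k$, and let $I$ be the Jacobian ideal of $I(\mathbb{X})$. Assume that $I(\mathbb{X})\cap I^t=I(\mathbb{X})\,I^{t-1}$ for every $2\leq t\leq s$. Then the Jacobian ideal of $I(\mathbb{X})$ is $\mathcal{VV}$-torsion free.
   Context: $k$ is an algebraically closed field of characteristic zero and $R=k[x_0,\ldots,x_n]$ is the homogeneous coordinate ring of $\mathbb{P}^n_k$. For a finite set $\mathbb{X}$ of distinct points of $\mathbb{P}^n_k$, $J=I(\mathbb{X})\subset R$ is its (radical) homogeneous defining ideal. Let $\Theta$ be the Jacobian matrix of a set of homogeneous generators of $J$, and $I_n(\Theta)\subset R$ the ideal generated by its $n\times n$ minors. The Jacobian ideal of $I(\mathbb{X})$ is $I=(J,I_n(\Theta))\subset R$ (equivalently its image $I/J$ in $R/J$); it does not depend on the choice of generators. The Jacobian ideal is called $\mathcal{VV}$-torsion free if the Valabrega--Valla module $\bigoplus_{t\ge 2}\frac{J\cap I^t}{J I^{t-1}}$ is zero, i.e. if $J\cap I^t=JI^{t-1}$ for all $t\geq 2$. *)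

(* Defs.v *)
From HB Require Import structures.
From mathcomp Require Import all_boot all_order all_algebra finmap.
From mathcomp.multinomials Require Import mpoly.

Set Implicit Arguments.
Unset Strict Implicit.
Unset Printing Implicit Defensive.

Import GRing.Theory.
Local Open Scope ring_scope.

(* Ideals are [Prop]-valued predicates, and not the [idealr] of ring_quotient,
   because the latter are decidable and proper: the Jacobian ideal may well be
   the unit ideal. *)
Section Ideals.
Variable R : comNzRingType.
Implicit Types (S A B : R -> Prop).

Definition ideal_gen S : R -> Prop := fun x =>
  exists (m : nat) (a g : 'I_m -> R),
    (forall i, S (g i)) /\ x = \sum_(i < m) a i * g i.

Definition ideal_add A B : R -> Prop := fun x =>
  exists a b, [/\ A a, B b & x = a + b].

Definition ideal_cap A B : R -> Prop := fun x => A x /\ B x.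

Definition ideal_mul A B : R -> Prop :=
  ideal_gen (fun x => exists a b, [/\ A a, B b & x = a * b]).

Fixpoint ideal_exp A (t : nat) : R -> Prop :=
  if t is t'.+1 then ideal_mul A (ideal_exp A t') else fun=> True.

Definition ideal_eq A B : Prop := forall x, A x <-> B x.

Definition VV_torsion_free (J I : R -> Prop) : Prop :=
  forall t : nat, (2 <= t)%N ->
    ideal_eq (ideal_cap J (ideal_exp I t)) (ideal_mul J (ideal_exp I t.-1)).

End Ideals.

(* The points of P^n are the lines through the origin of k^(n+1). *)
Definition proj_space (k : fieldType) (n : nat) : Type :=
  {U : {vspace 'rV[k]_n.+1} | \dim U == 1%N}.
HB.instance Definition _ (k : fieldType) (n : nat) :=
  Choice.on (proj_space k n).

Section Points.
Variables (k : fieldType) (n : nat).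
Implicit Types (f : {mpoly k[n.+1]}) (P : proj_space k n).

Definition homogeneous f : Prop := exists d : nat, f \is d.-homog.

(* For homogeneous [f], vanishing at one nonzero vector of the line [P] is the
   same as vanishing on all of [P]. *)
Definition vanishes_at f P : Prop :=
  forall v : 'rV[k]_n.+1, v \in val P -> f.@[v ord0] = 0.

Definition defining_ideal (X : {fset proj_space k n}) :
    {mpoly k[n.+1]} -> Prop :=
  ideal_gen (fun f => homogeneous f /\ forall P, P \in X -> vanishes_at f P).

Variables (m : nat) (F : 'I_m -> {mpoly k[n.+1]}).

Definition homogeneous_generators (J : {mpoly k[n.+1]} -> Prop) : Prop :=
  (forall i, homogeneous (F i)) /\
  ideal_eq (ideal_gen (fun f => exists i, f = F i)) J.

Definition jacobian_matrix : 'M[{mpoly k[n.+1]}]_(m, n.+1) :=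
  \matrix_(i < m, j < n.+1) (F i)^`M(j).

End Points.

Definition minors_ideal (R : comNzRingType) (p q r : nat) (M : 'M[R]_(p, q)) :
    R -> Prop :=
  ideal_gen (fun x =>
    exists (f : 'I_r -> 'I_p) (g : 'I_r -> 'I_q),
      [/\ {homo f : i j / (i < j)%N}, {homo g : i j / (i < j)%N}
        & x = \det (mxsub f g M)]).

Definition jacobian_ideal (k : fieldType) (n m : nat)
    (J : {mpoly k[n.+1]} -> Prop) (F : 'I_m -> {mpoly k[n.+1]}) :
    {mpoly k[n.+1]} -> Prop :=
  ideal_add J (minors_ideal n (jacobian_matrix F)).

(* Main.v *)
Require Import Defs.
From HB Require Import structures.
From Stdlib Require Import Classical.
From mathcomp Require Import all_boot all_order all_algebra finmap.
From mathcomp Require Import generic_quotient ring.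
From mathcomp.multinomials Require Import mpoly.

Set Implicit Arguments.
Unset Strict Implicit.
Unset Printing Implicit Defensive.

Import GRing.Theory.
Local Open Scope ring_scope.

(** Write K for the ideal of maximal minors, so that I = J + K. Restricting a
    polynomial to the lines of the s points embeds R/J into k[x]^s, and a
    linear form l that equals 1 at a chosen vector of each line restricts
    to x everywhere.

    The equality J /\ I^t = J I^(t-1) passes from t = s to all larger t
    because the powers of I/J are governed by a single element near the
    origin. Every ideal L of R satisfies dim_k (L + J)/(l L + J) <= s: s + 1
    vectors of k[x]^s are dependent over k[x] and a common factor x can be
    cancelled ([rank_mod_form]). For L = K^s this is the hypothesis of the
    theorem of Eakin and Sathaye ([eakin_sathaye]): some y in K has
    K^s = y K^(s-1) modulo l K^s + J. Using J /\ I^s = J I^(s-1), it follows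
    that for t >= s and every N
      I^t is contained in y I^(t-1) + l^N I^t + J I^(t-1)
    ([exp_sub_reduction_iter]).

    Let then x in J /\ I^(t+1) be homogeneous of degree d, and write
    x = y z + l^N w + j accordingly. The restriction of y z to each line is
    divisible by x^N. If y is nonzero on the line, this forces the components
    of z of low degree to vanish there; if not, genericity of y forces all of
    K to vanish there, hence also z, which lies in I = J + K. So the components
    z_e with e <= d lie in J /\ I^t, which is J I^(t-1) by induction, and in
    degree d the equation reads x = sum of y_i z_(d-i), plus an element of
    J I^t ([valabrega_valla_descent]).

    The element y is inhomogeneous in general, since the minors have different
    degrees; this is why the reduction holds only up to l^N, and why
    homogeneous components are taken at the end. *)

(** * Ideals as predicates *)

Section IdealPredicates.
Variable R : comNzRingType.
Implicit Types (S A B C : R -> Prop).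

Definition is_ideal A : Prop :=
  [/\ A 0, forall x y, A x -> A y -> A (x + y) & forall a x, A x -> A (a * x)].

Lemma idealT : is_ideal (fun=> True). Proof. by []. Qed.

Lemma ideal0 A : is_ideal A -> A 0. Proof. by case. Qed.
Lemma idealD A x y : is_ideal A -> A x -> A y -> A (x + y).
Proof. by case=> _ h _; exact: h. Qed.
Lemma idealM A a x : is_ideal A -> A x -> A (a * x).
Proof. by case=> _ _; apply. Qed.
Lemma idealN A x : is_ideal A -> A x -> A (- x).
Proof. by move=> iA Ax; rewrite -mulN1r; apply: idealM. Qed.
Lemma idealB A x y : is_ideal A -> A x -> A y -> A (x - y).
Proof. by move=> iA Ax Ay; apply: idealD => //; apply: idealN. Qed.

Lemma ideal_sum A (I : Type) (r : seq I) (P : pred I) (F : I -> R) :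
  is_ideal A -> (forall i, P i -> A (F i)) -> A (\sum_(i <- r | P i) F i).
Proof.
move=> iA h; elim/big_ind: _ => //; first exact: ideal0.
by move=> x y; exact: idealD.
Qed.

Lemma ideal_preimM A b : is_ideal A -> is_ideal (fun x => A (b * x)).
Proof.
move=> iA; split=> [|x y|a x]; first by rewrite mulr0; exact: ideal0.
  by rewrite mulrDr; exact: idealD.
by rewrite mulrCA; exact: idealM.
Qed.

Lemma ideal_gen_ideal S : is_ideal (ideal_gen S).
Proof.
split.
- by exists 0%N, (fun=> 0), (fun=> 0); split=> [[]//|]; rewrite big_ord0.
- move=> _ _ [m [a [g [Sg ->]]]] [p [b [h [Sh ->]]]].
  exists (m + p)%N,
    (fun i => match split i with inl j => a j | inr j => b j end),
    (fun i => match split i with inl j => g j | inr j => h j end).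
  split=> [i|]; first by case: (split i).
  rewrite big_split_ord /=; congr (_ + _); apply: eq_bigr => i _.
    by rewrite -/(unsplit (inl i)) unsplitK.
  by rewrite -/(unsplit (inr i)) unsplitK.
- move=> c _ [m [a [g [Sg ->]]]]; exists m, (fun i => c * a i), g; split=> //.
  by rewrite mulr_sumr; apply: eq_bigr => i _; rewrite mulrA.
Qed.

Lemma mem_ideal_gen S x : S x -> ideal_gen S x.
Proof.
by move=> Sx; exists 1%N, (fun=> 1), (fun=> x); rewrite big_ord1 mul1r.
Qed.

Lemma ideal_gen_min S A :
  is_ideal A -> (forall x, S x -> A x) -> forall x, ideal_gen S x -> A x.
Proof.
move=> iA SA _ [m [a [g [Sg ->]]]]; apply: ideal_sum => // i _.
by apply: idealM => //; apply: SA.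
Qed.

Lemma ideal_mul_ideal A B : is_ideal (ideal_mul A B).
Proof. exact: ideal_gen_ideal. Qed.

Lemma mem_ideal_mul A B a b : A a -> B b -> ideal_mul A B (a * b).
Proof. by move=> Aa Bb; apply: mem_ideal_gen; exists a, b. Qed.

Lemma ideal_mul_min A B C :
    is_ideal C -> (forall a b, A a -> B b -> C (a * b)) ->
  forall x, ideal_mul A B x -> C x.
Proof.
move=> iC h; apply: ideal_gen_min => // _ [a [b [Aa Bb ->]]]; exact: h.
Qed.

Lemma ideal_exp_ideal A t : is_ideal (ideal_exp A t).
Proof. by case: t => [|t]; [exact: idealT | exact: ideal_mul_ideal]. Qed.

(** For [t = 0] both powers are the unit ideal: this is the form in which the
    induction of [eakin_sathaye] can start at exponent zero. *)
Lemma ideal_expS_pred A t a x :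
  A a -> ideal_exp A t.-1 x -> ideal_exp A t (a * x).
Proof. by case: t => [//|t] Aa Ax; apply: mem_ideal_mul. Qed.

Lemma ideal_exp_sub A t x :
  is_ideal A -> (0 < t)%N -> ideal_exp A t x -> A x.
Proof.
case: t => [//|t] iA _; apply: ideal_mul_min => // a b Aa _.
by rewrite mulrC; exact: idealM.
Qed.

Lemma ideal_exp_mono A B t :
    (forall x, A x -> B x) -> forall x, ideal_exp A t x -> ideal_exp B t x.
Proof.
move=> AB; elim: t => [//|t IH] x; apply: ideal_mul_min => [|a b Aa Ab].
  exact: ideal_mul_ideal.
by apply: mem_ideal_mul; [exact: AB | exact: IH].
Qed.

Lemma ideal_add_ideal A B :
  is_ideal A -> is_ideal B -> is_ideal (ideal_add A B).
Proof.
move=> iA iB; split.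
- by exists 0, 0; split; rewrite ?addr0 //; exact: ideal0.
- move=> _ _ [a [b [Aa Bb ->]]] [a' [b' [Aa' Bb' ->]]].
  exists (a + a'), (b + b').
  by split; [exact: idealD | exact: idealD | rewrite addrACA].
- move=> c _ [a [b [Aa Bb ->]]].
  exists (c * a), (c * b).
  by split; [exact: idealM | exact: idealM | rewrite mulrDr].
Qed.

Lemma ideal_addl A B x : is_ideal B -> A x -> ideal_add A B x.
Proof.
by move=> iB Ax; exists x, 0; rewrite addr0; split=> //; exact: ideal0.
Qed.

Lemma ideal_addr A B x : is_ideal A -> B x -> ideal_add A B x.
Proof.
by move=> iA Bx; exists 0, x; rewrite add0r; split=> //; exact: ideal0.
Qed.

(** Expanding (j + a)^t, every term other than a^t has a factor in J. *)
Lemma ideal_exp_add J A t x : is_ideal J -> is_ideal A ->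
  ideal_exp (ideal_add J A) t x -> ideal_add J (ideal_exp A t) x.
Proof.
move=> iJ iA; elim: t x => [|t IH] x /=; first by move=> _; exact: ideal_addr.
apply: ideal_mul_min => [|_ y [j [a [Jj Aa ->]]] /IH [j' [b [Jj' Ab ->]]]].
  by apply: ideal_add_ideal => //; exact: ideal_mul_ideal.
exists (j * (j' + b) + a * j'), (a * b); split.
- by apply: idealD => //; [rewrite mulrC|]; exact: idealM.
- exact: mem_ideal_mul.
- by rewrite mulrDl [a * (_ + _)]mulrDr addrA.
Qed.

Lemma ideal_mul_expS J A t a x :
  A a -> ideal_mul J (ideal_exp A t) x ->
  ideal_mul J (ideal_exp A t.+1) (a * x).
Proof.
move=> Aa; apply: (@ideal_mul_min _ _ (fun x => ideal_mul _ _ (a * x))).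
  by apply: ideal_preimM; exact: ideal_mul_ideal.
move=> j b Jj Ab; rewrite mulrCA; apply: mem_ideal_mul => //.
exact: mem_ideal_mul.
Qed.

Definition dilate a A : R -> Prop := fun x => exists2 u, A u & x = a * u.

Lemma dilate_ideal a A : is_ideal A -> is_ideal (dilate a A).
Proof.
move=> iA; split.
- by exists 0; rewrite ?mulr0 //; exact: ideal0.
- move=> _ _ [u Au ->] [w Aw ->].
  by exists (u + w); rewrite ?mulrDr //; exact: idealD.
- by move=> c _ [u Au ->]; exists (c * u); [exact: idealM | rewrite mulrCA].
Qed.

End IdealPredicates.

(** * Rank modulo a subspace *)

Section RankModulo.
Variables (k : fieldType) (R : comAlgType k).
Implicit Types (N U A : R -> Prop).

Lemma idealZ A (c : k) x : is_ideal A -> A x -> A (c *: x).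
Proof. by move=> iA Ax; rewrite -mulr_algl; apply: idealM. Qed.

Definition free_mod N r (v : 'I_r -> R) : Prop :=
  forall a : 'I_r -> k, N (\sum_i a i *: v i) -> forall i, a i = 0.

(** The dimension of (U + N)/N is at least [r]; stated as a predicate because
    the spaces involved are infinite-dimensional and not decidable. *)
Definition rank_ge N U r : Prop :=
  exists2 v : 'I_r -> R, (forall i, U (v i)) & free_mod N v.

Lemma rank_ge0 N U : rank_ge N U 0.
Proof. by exists (fun=> 0) => [[]|a _ []]. Qed.

(** Modulo [N], a subspace of finite dimension which contains another of at
    least that dimension equals it. *)
Lemma sub_of_rank N U U' r :
    is_ideal N -> is_ideal U ->
    (forall x, U x -> ideal_add U' N x) ->
    rank_ge N U r -> ~ rank_ge N U' r.+1 ->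
  forall x, U' x -> ideal_add U N x.
Proof.
move=> iN iU UU' [v Uv fv] nU' x U'x.
have /fin_all_exists2 [w U'w Nvw] : forall i, exists2 w, U' w & N (v i - w).
  move=> i; have [w [m [U'w Nm ->]]] := UU' _ (Uv i).
  by exists w; rewrite // addrAC subrr add0r.
have swap (a : 'I_r -> k) : N (\sum_i a i *: v i - \sum_i a i *: w i).
  rewrite -sumrB; apply: ideal_sum => // i _; rewrite -scalerBr.
  exact: idealZ.
pose u (i : 'I_r.+1) := if unlift ord0 i is Some j then w j else x.
have uS a : \sum_i a i *: u i = a ord0 *: x + \sum_i a (lift ord0 i) *: w i.
  rewrite big_ord_recl /u unlift_none; congr (_ + _).
  by apply: eq_bigr => i _; rewrite liftK.
have [fu|] := classic (free_mod N u).
  by case: nU'; exists u => // i; rewrite /u; case: (unlift _ _).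
move=> nfu; have [a na'] := not_all_ex_not _ _ nfu.
have [Na na] := imply_to_and _ _ na'.
move: Na; rewrite uS => Na; set b := fun i => a (lift ord0 i) in Na.
(* Otherwise the relation would be one between the [v i]. *)
have a0 : a ord0 != 0.
  apply: contra_notN na => /eqP a0 i.
  have b0 : forall j, b j = 0.
    apply: fv; rewrite -[X in N X](subrK (\sum_i b i *: w i)).
    by apply: idealD => //; move: Na; rewrite a0 scale0r add0r.
  by case: (unliftP ord0 i) => [j ->|->]; [exact: b0 | ].
pose y := - (a ord0)^-1 *: \sum_i b i *: v i.
exists y, (x - y); split; last by rewrite addrC subrK.
- by apply: idealZ => //; apply: ideal_sum => // i _; apply: idealZ.
- have -> : x - y = (a ord0)^-1 *: ((a ord0 *: x + \sum_i b i *: w i)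
      + (\sum_i b i *: v i - \sum_i b i *: w i)).
    rewrite [\sum_i b i *: v i - _]addrC addrA addrK scalerDr scalerA.
    rewrite mulVf // scale1r.
    by rewrite /y scaleNr opprK.
  by apply: idealZ => //; apply: idealD.
Qed.

End RankModulo.

(** * The theorem of Eakin and Sathaye *)

Section EakinSathaye.

Definition infinitely (E : nat -> Prop) : Prop :=
  forall b, exists2 c, (b <= c)%N & E c.

Definition eventually (E : nat -> Prop) : Prop :=
  exists b, forall c, (b <= c)%N -> E c.

Lemma not_eventually E : ~ eventually E -> infinitely (fun c => ~ E c).
Proof.
move=> nE b; apply: NNPP => nc; apply: nE; exists b => c bc.
by apply: NNPP => nEc; apply: nc; exists c.
Qed.

Lemma infinitely_and E E' :
  infinitely E -> eventually E' -> infinitely (fun c => E c /\ E' c).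
Proof.
move=> iE [b bE'] b'; have [c] := iE (maxn b b').
by rewrite geq_max => /andP[bc b'c] Ec; exists c => //; split=> //; exact: bE'.
Qed.

Lemma eventually_and E E' :
  eventually E -> eventually E' -> eventually (fun c => E c /\ E' c).
Proof.
move=> [b bE] [b' bE']; exists (maxn b b') => c.
by rewrite geq_max => /andP[/bE ? /bE' ?].
Qed.

Lemma eventually_all (T : finType) (E : T -> nat -> Prop) :
  (forall i, eventually (E i)) -> eventually (fun c => forall i, E i c).
Proof.
move=> h; have /fin_all_exists [b bE] := h.
exists (\max_i b i) => c bc i; apply: bE; exact: leq_trans (leq_bigmax i) bc.
Qed.

(** A pigeonhole: the largest [q] such that [Q c q] for infinitely many [c]
    is attained exactly infinitely often. *)
Lemma infinitely_exact_level (E : nat -> Prop) (Q : nat -> nat -> Prop) r :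
    infinitely E -> (forall c, E c -> Q c 0%N) -> (forall c, E c -> ~ Q c r) ->
  exists q, infinitely (fun c => [/\ E c, Q c q & ~ Q c q.+1]).
Proof.
elim: r => [|r IH] in E * => iE E0 Er.
  by have [c _ Ec] := iE 0%N; case: (Er c Ec (E0 c Ec)).
have [ev|nev] := classic (eventually (fun c => E c -> ~ Q c r)).
  have [|c [Ec _]|c [Ec]|q iq] := IH (fun c => E c /\ (E c -> ~ Q c r)).
  - exact: infinitely_and.
  - exact: E0.
  - exact.
  - by exists q => b; have [c bc [[]]] := iq b; exists c.
exists r => b; have [c bc nc] := not_eventually nev b; exists c => //.
have [Ec nnQ] := imply_to_and _ _ nc.
by split=> //; [exact: NNPP | exact: Er].
Qed.

Variables (k : fieldType) (R : comAlgType k).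
Implicit Types (N I : R -> Prop) (a : R) (y : nat -> R).

(** This replaces genericity: a finite exceptional set of parameters can
    always be avoided, and what remains still generates [I]. *)
Definition generating_family I y : Prop :=
  (forall c, I (y c)) /\
  forall E A, infinitely E -> is_ideal A -> (forall c, E c -> A (y c)) ->
    forall x, I x -> A x.

(** If a I^j has dimension at most j modulo N, then a I^j = y a I^(j-1) modulo N
    for almost all members y of a generating family. Induction on j: were y_c
    bad for infinitely many c, the spaces y_c a I^(j-1) would have dimension
    at most j - 1, and infinitely many of them the same dimension. Fix one of
    these, for c = c0. By induction applied to y_c0 a, for almost all c the
    space y_c0 a I^(j-1) equals y_c y_c0 a I^(j-2), so it lies in
    y_c a I^(j-1), and the two are equal by dimension. Hence
    y_c a I^(j-1) lies in y_c0 a I^(j-1) for infinitely many c. As these y_c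
    generate I, all of a I^j lies there, and c0 was not bad after all. *)
Theorem eakin_sathaye N I y j a :
    is_ideal N -> generating_family I y ->
    ~ rank_ge N (dilate a (ideal_exp I j)) j.+1 ->
  eventually (fun c => forall x, dilate a (ideal_exp I j) x ->
    ideal_add (dilate (y c * a) (ideal_exp I j.-1)) N x).
Proof.
move=> iN [Iy geny].
have iD b t : is_ideal (dilate b (ideal_exp I t)).
  by apply: dilate_ideal; exact: ideal_exp_ideal.
have step c b t x :
    dilate (y c * b) (ideal_exp I t.-1) x -> dilate b (ideal_exp I t) x.
  move=> [u Iu ->]; exists (y c * u); last by rewrite mulrCA mulrA.
  by apply: ideal_expS_pred.
elim: j a => [|j IH] a rk; apply: NNPP => /not_eventually iE.
  have [c _] := iE 0%N; apply.
  apply: sub_of_rank (rank_ge0 _ _) rk => // x hx.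
  by apply: ideal_addl => //; apply: step hx.
set bad := fun c => ~ _ in iE.
have rk_bad c : bad c -> ~ rank_ge N (dilate (y c * a) (ideal_exp I j)) j.+1.
  move=> bc rc; apply: bc; apply: sub_of_rank rc rk => // x hx.
  by apply: ideal_addl => //; exact: (step c a j.+1).
have [|q iq] := infinitely_exact_level (Q := fun c =>
    rank_ge N (dilate (y c * a) (ideal_exp I j))) iE _ rk_bad.
  by move=> c _; exact: rank_ge0.
have [c0 _ [bc0 q0 _]] := iq 0%N.
have good := IH _ (rk_bad _ bc0).
apply: bc0 => x [u Iu ->].
have iA := ideal_add_ideal (iD (y c0 * a) j) iN.
move: u Iu; apply: ideal_mul_min; first exact: ideal_preimM.
move=> b u Ib Iu; have -> : a * (b * u) = a * u * b by rewrite mulrA mulrAC.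
move: b Ib; apply: (geny _ _ (infinitely_and iq good)).
  exact: ideal_preimM.
move=> c [[_ qc nqc] goodc].
have -> : a * u * y c = y c * a * u by rewrite mulrC mulrA.
apply: (sub_of_rank iN _ _ q0 nqc) => //; last by exists u.
move=> z /goodc [w [m [hw Nm ->]]].
exists w, m; split=> //; apply: (step c0).
by rewrite mulrCA.
Qed.

End EakinSathaye.

(** * Generating families from finitely many generators *)

Section MomentCurve.

Lemma infinitely_enum (E : nat -> Prop) q : infinitely E ->
  exists2 e : 'I_q -> nat, injective e & forall i, E (e i).
Proof.
move=> iE.
have [s [sz us sE]] : exists s,
    [/\ size s = q, uniq s & forall c, c \in s -> E c].
  elim: q => [|q [s [<- us sE]]]; first by exists [::].
  have [c cb Ec] := iE (\max_(x <- s) x).+1; exists (c :: s); split=> //=.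
    rewrite us andbT; apply: contraL cb => cs.
    by rewrite -leqNgt (leq_bigmax_seq (F := id)).
  by move=> d; rewrite inE => /predU1P[->|/sE].
exists (fun i : 'I_q => nth 0%N s i) => [i j /eqP|i].
  by rewrite nth_uniq ?sz // => /eqP; exact: val_inj.
by apply/sE/mem_nth; rewrite sz.
Qed.

Variables (k : fieldType) (R : comAlgType k) (char0 : [pchar k] =i pred0).

Definition moment_curve q (f : 'I_q -> R) (c : nat) : R :=
  \sum_(i < q) ((c%:R : k) ^+ i) *: f i.

Lemma natr_inj_char0 : injective (fun c : nat => c%:R : k).
Proof.
have c0 := (pcharf0P k).1 char0.
have main a b : (a <= b)%N -> a%:R = b%:R :> k -> a = b.
  move=> ab e; have := c0 (b - a)%N.
  rewrite natrB // e subrr eqxx => /esym.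
  by rewrite subn_eq0 => ba; apply/eqP; rewrite eqn_leq ab.
move=> a b e; have [ab|/ltnW ba] := leqP a b; first exact: main.
by apply/esym/main.
Qed.

(** Any [q] points of the moment curve span the space of the [f i], by the
    Vandermonde determinant. *)
Lemma moment_curve_generating (I : R -> Prop) q (f : 'I_q -> R) :
    is_ideal I -> (forall i, I (f i)) ->
    (forall A, is_ideal A -> (forall i, A (f i)) -> forall x, I x -> A x) ->
  generating_family I (moment_curve f).
Proof.
move=> iI If minI; split=> [c|E A iE iA AE].
  by apply: ideal_sum => // i _; apply: idealZ.
apply: minI => // l.
have [e e_inj Ee] := infinitely_enum q iE.
pose V := Vandermonde q (\row_j ((e j)%:R : k)).
have uV : V \in unitmx.
  rewrite unitmxE det_Vandermonde unitfE; apply/prodf_neq0 => i _.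
  apply/prodf_neq0 => j ij; rewrite !mxE subr_eq0.
  apply/eqP => /natr_inj_char0/e_inj ji.
  by rewrite ji ltnn in ij.
have -> : f l = \sum_j invmx V j l *: moment_curve f (e j).
  under eq_bigr do rewrite scaler_sumr.
  rewrite exchange_big /= -[LHS]scale1r.
  have VK (i : 'I_q) : \sum_j invmx V j l * (e j)%:R ^+ i = (i == l)%:R.
    have /matrixP/(_ i l) := mulmxV uV; rewrite !mxE => <-.
    by apply: eq_bigr => j _; rewrite !mxE mulrC.
  rewrite (eq_bigr (fun i => (i == l)%:R *: f i)) => [|i _]; last first.
    by under eq_bigr do rewrite scalerA; rewrite -scaler_suml VK.
  rewrite (bigD1 l) //= eqxx big1 ?addr0 // => i /negPf ->.
  by rewrite scale0r.
by apply: ideal_sum => // j _; apply: idealZ => //; apply: AE.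
Qed.

End MomentCurve.

(** * Homogeneous components and restriction to lines *)

Section Spread.
Variables (k : fieldType) (n : nat).
Implicit Types (f p q : {mpoly k[n]}) (v : 'I_n -> k).
Implicit Types (A B S : {mpoly k[n]} -> Prop).

(** The substitution X_i |-> X_i T, whose coefficient at T^d is the homogeneous
    component of degree [d]. Being a ring morphism, it turns statements on
    components of products into statements on coefficients. *)
Definition spread : {mpoly k[n]} -> {poly {mpoly k[n]}} :=
  mmap (polyC \o @mpolyC n k) (fun i => ('X_i)%:P * 'X).

Lemma spreadE p :
  spread p = \sum_(m <- msupp p) (p@_m *: 'X_[m])%:P * 'X^(mdeg m).
Proof.
apply: eq_bigr => m _; rewrite -mul_mpolyC polyCM -mulrA; congr (_ * _).
rewrite /mmap1; under eq_bigr do rewrite exprMn.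
rewrite big_split /= prodrXr -mdegE; congr (_ * _).
rewrite mpolyXE_id rmorph_prod /=.
by apply: eq_bigr => i _; rewrite rmorphXn.
Qed.

HB.instance Definition _ := GRing.RMorphism.copy spread
  (mmap (polyC \o @mpolyC n k) (fun i => ('X_i)%:P * 'X)).

Lemma spread_homog d f : f \is d.-homog -> spread f = f%:P * 'X^d.
Proof.
move=> /dhomogP hf; rewrite spreadE [in RHS](mpolyE f) rmorph_sum mulr_suml.
by apply: eq_big_seq => m /hf <-.
Qed.

Lemma spread_coef_homog d p : (spread p)`_d \is d.-homog.
Proof.
rewrite spreadE coef_sum; apply: rpred_sum => m _.
rewrite coefCM coefXn; case: eqP => [->|_]; last by rewrite mulr0 rpred0.
by rewrite mulr1 dhomogZ // dhomogX.
Qed.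

Lemma spread_sum p : p = \sum_(d < size (spread p)) (spread p)`_d.
Proof.
have <- : (spread p).[1] = \sum_(d < size (spread p)) (spread p)`_d.
  by rewrite horner_coef; apply: eq_bigr => i _; rewrite expr1n mulr1.
rewrite spreadE horner_sum [LHS]mpolyE; apply: eq_bigr => m _.
by rewrite !hornerE expr1n mulr1.
Qed.

(** The restriction x |-> p (x v) of [p] to the line through [v]. *)
Definition line v : {mpoly k[n]} -> {poly k} := map_poly (meval v) \o spread.

HB.instance Definition _ v := GRing.RMorphism.on (line v).

Lemma coef_line v p d : (line v p)`_d = ((spread p)`_d).@[v].
Proof. by rewrite coef_map. Qed.

Lemma line_homog v d f : f \is d.-homog -> line v f = (f.@[v])%:P * 'X^d.
Proof.
move=> hf; rewrite /line /= (spread_homog hf) rmorphM /=.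
by rewrite map_polyC map_polyXn.
Qed.

Lemma lineC v c : line v c%:MP = c%:P.
Proof.
rewrite (@line_homog v 0) ?mevalC ?mulr1 //.
by rewrite -[c%:MP]mulr1 mul_mpolyC dhomogZ // dhomog1.
Qed.

Lemma line_ker_ideal v : is_ideal (fun p => line v p = 0).
Proof.
split=> [|p q hp hq|a p hp]; first by rewrite raddf0.
  by rewrite raddfD /= hp hq addr0.
by rewrite rmorphM /= hp mulr0.
Qed.

Definition homog_ideal A : Prop :=
  is_ideal A /\ forall p d, A p -> A (spread p)`_d.

Lemma homog_ideal_mul A B :
  homog_ideal A -> homog_ideal B -> homog_ideal (ideal_mul A B).
Proof.
move=> [iA hA] [iB hB]; split=> [|p d Ap]; first exact: ideal_mul_ideal.
have iAB := ideal_mul_ideal A B.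
move: p Ap d; apply: ideal_mul_min => [|a b Aa Bb d].
  split=> [d|x y hx hy d|c x hx d].
  - by rewrite raddf0 coef0; exact: (ideal0 iAB).
  - by rewrite raddfD coefD; exact: (idealD iAB (hx d) (hy d)).
  - rewrite rmorphM coefM; apply: (ideal_sum _ iAB) => // i _.
    exact: (idealM _ iAB (hx _)).
rewrite rmorphM coefM; apply: (ideal_sum _ iAB) => // i _.
by apply: mem_ideal_mul; auto.
Qed.

Lemma homog_ideal_exp A t : homog_ideal A -> homog_ideal (ideal_exp A t).
Proof.
by move=> hA; elim: t => [|t IH]; [split | exact: homog_ideal_mul].
Qed.

Lemma homog_ideal_gen S :
  (forall p, S p -> exists d, p \is d.-homog) -> homog_ideal (ideal_gen S).
Proof.
have iS := ideal_gen_ideal S.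
move=> hS; split=> // p d Sp; move: p Sp d.
apply: ideal_gen_min => [|p Sp d].
  split=> [d|x y hx hy d|c x hx d].
  - by rewrite raddf0 coef0; exact: (ideal0 iS).
  - by rewrite raddfD coefD; exact: (idealD iS (hx d) (hy d)).
  - rewrite rmorphM coefM; apply: (ideal_sum _ iS) => // i _.
    exact: (idealM _ iS (hx _)).
have [e he] := hS p Sp; rewrite (spread_homog he) coefMXn coefC.
case: ifP => _; first exact: (ideal0 iS).
by case: ifP => _; [exact: mem_ideal_gen | exact: (ideal0 iS)].
Qed.

Lemma homog_ideal_add A B :
  homog_ideal A -> homog_ideal B -> homog_ideal (ideal_add A B).
Proof.
move=> [iA hA] [iB hB]; split=> [|_ d [a [b [Aa Bb ->]]]].
  exact: ideal_add_ideal.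
by exists (spread a)`_d, (spread b)`_d; split; auto; rewrite raddfD coefD.
Qed.

End Spread.

(** * Ideals modulo a linear form *)

Section RankBound.

Lemma fraction_quotient (D : idomainType) (x : {fraction D}) :
  exists2 nd : D * D, nd.2 != 0 & x = tofrac nd.1 / tofrac nd.2.
Proof.
elim/quotW: x => x; exists (\n_x, \d_x); first exact: denom_ratioP.
have dx : tofrac (\d_x) != 0 by rewrite tofrac_eq0 denom_ratioP.
apply: (mulIf dx); rewrite divfK //=.
apply/eqP; rewrite -[_ * _]/(FracField.mul _ _) !piE /FracField.mulf.
rewrite FracField.equivfE !numden_Ratio ?mulr1 ?oner_eq0 ?denom_ratioP //.
by rewrite mulrC.
Qed.

(** Linear algebra over the fraction field, with denominators cleared. *)
Lemma tall_matrix_dependent (D : idomainType) s (M : 'M[D]_(s.+1, s)) :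
  exists2 a : 'rV[D]_s.+1, a != 0 & a *m M = 0.
Proof.
pose N := map_mx (@tofrac D) M.
have /rowV0Pn [w /sub_kermxP wN w0] : kermx N != 0.
  by rewrite kermx_eq0 /row_free neq_ltn ltnS rank_leq_col.
have /fin_all_exists2 [nd d0 wE] : forall i, exists2 nd : D * D,
    nd.2 != 0 & w 0 i = tofrac nd.1 / tofrac nd.2.
  by move=> i; exact: fraction_quotient.
pose d := \prod_i (nd i).2.
have dn0 : d != 0 by apply/prodf_neq0 => i _.
pose a := \row_i ((nd i).1 * \prod_(j | j != i) (nd j).2).
have aE : map_mx (@tofrac D) a = tofrac d *: w.
  apply/rowP => i; rewrite !mxE wE.
  have -> : d = (nd i).2 * \prod_(j | j != i) (nd j).2 by rewrite /d (bigD1 i).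
  rewrite [tofrac (_ * _)]tofracM [tofrac ((nd i).2 * _)]tofracM.
  by rewrite [RHS]mulrC -mulrA mulKf // tofrac_eq0.
exists a.
  apply: contraNneq w0 => a0; move: aE; rewrite a0 map_mx0 => /esym/eqP.
  by rewrite scaler_eq0 tofrac_eq0 (negPf dn0).
apply/rowP => j; apply/eqP; rewrite -tofrac_eq; apply/eqP.
have aMN : map_mx (@tofrac D) (a *m M) = 0.
  by rewrite map_mxM aE -scalemxAl wN scaler0.
by have /rowP/(_ j) := aMN; rewrite !mxE tofrac0.
Qed.

Variable k : fieldType.

(** Cancel the largest power of x that divides a relation. *)
Lemma poly_tall_matrix_dependent s (M : 'M[{poly k}]_(s.+1, s)) :
  exists2 a : 'rV[{poly k}]_s.+1, (exists i, (a 0 i)`_0 != 0) & a *m M = 0.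
Proof.
have [a a0 aM] := tall_matrix_dependent M.
have [i ai] : exists i, a 0 i != 0.
  apply/existsP; apply: contraNT a0; rewrite negb_exists => /forallP h.
  by apply/eqP/rowP => i; rewrite mxE; apply/eqP/negPn.
elim: {a0}(size (a 0 i)) {-2}a (leqnn (size (a 0 i))) ai aM => [|z IH] b.
  by rewrite leqn0 size_poly_eq0 => /eqP ->; rewrite eqxx.
move=> sz bi bM; have [|nb] := classic (exists j, (b 0 j)`_0 != 0).
  by exists b.
have b0 j : (b 0 j)`_0 = 0 by apply/eqP/negPn/negP => h; apply: nb; exists j.
pose c := \row_j Poly (behead (b 0 j)) : 'rV[{poly k}]_s.+1.
have bE : b = 'X *: c.
  apply/rowP => j; rewrite !mxE; apply/polyP => e; rewrite coefXM.
  by case: e => [|e] /=; rewrite ?b0 // coef_Poly nth_behead.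
have X0 : ('X : {poly k}) != 0 by rewrite polyX_eq0.
have ci : c 0 i != 0.
  by apply: contraNneq bi => ci; rewrite bE mxE ci mulr0.
apply: (IH c) => //; first by move: sz; rewrite bE mxE mulrC size_mulX.
apply/rowP => j; apply: (mulfI X0).
by have /rowP/(_ j) := bM; rewrite bE -scalemxAl !mxE mulr0.
Qed.

Variables (n s : nat) (v : 'I_s -> 'I_n -> k) (l : {mpoly k[n]}).
Hypotheses (l_homog : l \is 1.-homog) (l_v : forall i, l.@[v i] = 1).

Lemma line_form i : line (v i) l = 'X.
Proof. by rewrite (line_homog _ l_homog) l_v mul1r. Qed.

Variable J : {mpoly k[n]} -> Prop.
Hypothesis J_lines : forall f, J f <-> forall i, line (v i) f = 0.

Lemma lines_ideal : is_ideal J.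
Proof.
have ik i := line_ker_ideal (v i).
split=> [|x y /J_lines hx /J_lines hy|a x /J_lines hx]; apply/J_lines => i.
- exact: ideal0 (ik i).
- exact: (idealD (ik i) (hx i) (hy i)).
- exact: (idealM _ (ik i) (hx i)).
Qed.

Definition mod_form (K : {mpoly k[n]} -> Prop) := ideal_add (dilate l K) J.

(** A k[x]-linear relation sum_i a_i g_i = 0 on the lines lifts to the
    element sum_i a_i(l) g_i of J, which modulo l K is sum_i a_i(0) g_i. *)
Lemma rank_mod_form K : is_ideal K -> ~ rank_ge (mod_form K) K s.+1.
Proof.
move=> iK [g Kg fg].
pose M := \matrix_(i < s.+1, j < s) line (v j) (g i).
have [a [i0 ai0] aM] := poly_tall_matrix_dependent M.
suff /fg/(_ i0)/eqP : mod_form K (\sum_i (a 0 i)`_0 *: g i) by apply/negP.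
pose sub (p : {poly k}) := (map_poly (@mpolyC n k) p).[l].
have line_sub p j : line (v j) (sub p) = p.
  rewrite /sub -horner_map /= line_form -map_poly_comp /=.
  rewrite (@eq_map_poly _ _ _ polyC) => [|c /=]; last exact: lineC.
  exact: comp_polyXr.
pose tl (p : {poly k}) : {poly k} := Poly (behead p).
have sub_tl p : sub p = (p`_0)%:MP + l * sub (tl p).
  have {1}-> : p = (p`_0)%:P + tl p * 'X.
    apply/polyP => -[|e]; rewrite coefD coefC coefMX /= ?addr0 ?add0r //.
    by rewrite coef_Poly nth_behead.
  by rewrite /sub rmorphD rmorphM /= map_polyC map_polyX !hornerE mulrC.
exists (l * - \sum_i sub (tl (a 0 i)) * g i), (\sum_i sub (a 0 i) * g i).
split.
- exists (- \sum_i sub (tl (a 0 i)) * g i) => //.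
  by apply: idealN => //; apply: ideal_sum => // i _; exact: idealM.
- apply/J_lines => j; rewrite raddf_sum /=.
  have /matrixP/(_ 0 j) := aM; rewrite !mxE => aMj; rewrite -[RHS]aMj.
  by apply: eq_bigr => i _; rewrite rmorphM /= line_sub mxE.
- rewrite mulrN mulr_sumr addrC -sumrB; apply: eq_bigr => i _.
  by rewrite sub_tl mulrDl -mulrA addrK mul_mpolyC.
Qed.

End RankBound.

(** * The reduction propagates to higher powers *)

Section ReductionPropagates.
Variables (R : comNzRingType) (J K : R -> Prop) (s : nat) (y l : R).
Hypotheses (iJ : is_ideal J) (iK : is_ideal K) (Ky : K y) (s_gt0 : (0 < s)%N).
Let I := ideal_add J K.
Hypothesis K_red : forall x, ideal_exp K s x ->
  ideal_add (dilate y (ideal_exp K s.-1))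
    (ideal_add (dilate l (ideal_exp K s)) J) x.
Hypothesis vv_s :
  forall x, J x -> ideal_exp I s x -> ideal_mul J (ideal_exp I s.-1) x.

(** For u = s the remainder in J lies in I^s, hence in J I^(s-1) by [vv_s].
    Multiplication by I gives the higher powers. *)
Lemma exp_sub_reduction u : (s <= u)%N -> forall x, ideal_exp I u x ->
  ideal_add (dilate y (ideal_exp I u.-1))
    (ideal_add (dilate l (ideal_exp I u)) (ideal_mul J (ideal_exp I u.-1))) x.
Proof.
have KI x : K x -> I x by exact: ideal_addr.
have Iy := KI _ Ky.
have iIt t := ideal_exp_ideal I t.
have iJI t := ideal_mul_ideal J (ideal_exp I t).
elim: u => [|u IH]; first by rewrite leqNgt s_gt0.
have iC : is_ideal (ideal_add (dilate y (ideal_exp I u))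
    (ideal_add (dilate l (ideal_exp I u.+1)) (ideal_mul J (ideal_exp I u)))).
  by do ?apply: ideal_add_ideal; do ?apply: dilate_ideal.
rewrite leq_eqVlt => /predU1P[su|].
  move=> x Ix; have [j [x' [Jj Kx' xE]]] := ideal_exp_add iJ iK Ix.
  have := K_red; rewrite su in Kx' * => /(_ x' Kx').
  move=> [_ [_ [[z Kz ->] [_ [j' [[w Kw ->] Jj' ->]]] x'E]]].
  have Iz := ideal_exp_mono KI Kz; have Iw := ideal_exp_mono KI Kw.
  exists (y * z), (l * w + (j + j')); split; first by exists z.
    exists (l * w), (j + j'); split=> //; first by exists w.
    have := vv_s; rewrite su; apply; first exact: idealD.
    (* The part in J is a difference of elements of I^s. *)
    have -> : j + j' = x - y * z - l * w by rewrite xE x'E; ring.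
    apply: idealB => //; last exact: idealM.
    by apply: idealB => //; apply: mem_ideal_mul.
  by rewrite xE x'E; ring.
rewrite ltnS => su; apply: ideal_mul_min => // a x Ia /(IH su).
have u0 : (0 < u)%N by exact: leq_trans su.
move=> [_ [_ [[z Iz ->] [_ [j [[w Iw ->] Jj ->]]] ->]]].
exists (y * (a * z)), (l * (a * w) + a * j); split.
- by exists (a * z) => //; apply: ideal_expS_pred.
- exists (l * (a * w)), (a * j); split=> //.
    by exists (a * w) => //; apply: mem_ideal_mul.
  by rewrite -(prednK u0); apply: ideal_mul_expS.
- by ring.
Qed.

Lemma exp_sub_reduction_iter N u : (s <= u)%N -> forall x, ideal_exp I u x ->
  exists z w j, [/\ ideal_exp I u.-1 z, ideal_exp I u w,
    ideal_mul J (ideal_exp I u.-1) j & x = y * z + l ^+ N * w + j].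
Proof.
have iIt t := ideal_exp_ideal I t.
have iJI t := ideal_mul_ideal J (ideal_exp I t).
move=> su x Ix; elim: N => [|N [z [w [j [Iz Iw Jj ->]]]]].
  exists 0, x, 0; split=> //; try exact: ideal0.
  by rewrite mulr0 add0r expr0 mul1r addr0.
have [_ [_ [[z' Iz' ->] [_ [j' [[w' Iw' ->] Jj' ->]]] ->]]] :=
  exp_sub_reduction su Iw.
exists (z + l ^+ N * z'), w', (j + l ^+ N * j'); split=> //.
- by apply: idealD => //; exact: idealM.
- by apply: idealD => //; exact: idealM.
- by rewrite exprS; ring.
Qed.

End ReductionPropagates.

(** * Descent of the Valabrega-Valla equality *)

Section Descent.
Variables (k : fieldType) (char0 : [pchar k] =i pred0).
Variables (n s : nat) (v : 'I_s -> 'I_n -> k) (l : {mpoly k[n]}).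
Hypotheses (l_homog : l \is 1.-homog) (l_v : forall i, l.@[v i] = 1).
Variable J : {mpoly k[n]} -> Prop.
Hypothesis J_lines : forall f, J f <-> forall i, line (v i) f = 0.

Lemma lines_homog_ideal : homog_ideal J.
Proof.
split=> [|p d /J_lines Jp]; first exact: lines_ideal J_lines.
apply/J_lines => i; rewrite (line_homog _ (spread_coef_homog d p)).
by rewrite -coef_line Jp coef0 mul0r.
Qed.

Variables (K : {mpoly k[n]} -> Prop) (q : nat) (f : 'I_q -> {mpoly k[n]}).
Hypotheses (K_homog : homog_ideal K) (Kf : forall i, K (f i)).
Hypothesis K_min : forall A, is_ideal A -> (forall i, A (f i)) ->
  forall x, K x -> A x.

(** The second clause makes [y] vanish only on the lines on which [K] does: if
    infinitely many members of a generating family vanish on a line, the ideal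
    of the line contains [K]. *)
Lemma exists_local_reduction : exists y,
  [/\ K y,
      forall i, line (v i) y = 0 -> forall x, K x -> line (v i) x = 0
    & forall x, ideal_exp K s x ->
        ideal_add (dilate y (ideal_exp K s.-1))
          (mod_form l J (ideal_exp K s)) x].
Proof.
have iK := K_homog.1; have iJ := lines_ideal J_lines.
have iKs := ideal_exp_ideal K s.
have genK := moment_curve_generating char0 iK Kf K_min.
set N := mod_form _ _ _.
have iN : is_ideal N by apply: ideal_add_ideal => //; exact: dilate_ideal.
have rk1 : ~ rank_ge N (dilate 1 (ideal_exp K s)) s.+1.
  move=> [g gK fg]; apply: (rank_mod_form l_homog l_v J_lines iKs).
  by exists g => // i; have [u Ku ->] := gK i; rewrite mul1r.
have ev_line : eventually (fun c => forall i,
    line (v i) (moment_curve f c) = 0 -> forall x, K x -> line (v i) x = 0).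
  apply: eventually_all => i; apply: NNPP => /not_eventually inf.
  have K0 x : K x -> line (v i) x = 0.
    apply: (genK.2 _ (fun x => line (v i) x = 0) inf) => [|c nc].
      exact: line_ker_ideal.
    by apply: NNPP => nl; apply: nc => hl; case: (nl hl).
  by have [c _] := inf 0%N; apply.
have [b hb] := eventually_and (eakin_sathaye iN genK rk1) ev_line.
have [red nz] := hb b (leqnn b).
exists (moment_curve f b); split=> //; first exact: genK.1.
move=> x Kx; have := red x; rewrite mulr1; apply.
by exists x; rewrite ?mul1r.
Qed.

(** The order of vanishing of [y] at 0 is less than its size, and the order of
    a product is the sum of the orders. *)
Lemma coef_eq0_cofactor (y z w : {poly k}) N e :
  y != 0 -> y * z = 'X^N * w -> (e + size y <= N)%N -> z`_e = 0.
Proof.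
move=> y0 yz.
have yn : exists b, y`_b != 0.
  by exists (size y).-1; rewrite -lead_coefE lead_coef_eq0.
case: (ex_minnP yn) => b yb minb.
have by_ : (b < size y)%N.
  by rewrite ltnNge; apply: contra yb => /(nth_default _) ->.
elim/ltn_ind: e => e IH he.
have : (y * z)`_(b + e) = 0.
  rewrite yz mulrC coefMXn ifT //; apply: leq_trans he.
  by rewrite addnC ltn_add2l.
have bl : (b < (b + e).+1)%N by rewrite ltnS leq_addr.
rewrite coefM (bigD1 (Ordinal bl)) //= addKn big1 ?addr0 => [/eqP|i ib].
  by rewrite mulf_eq0 (negPf yb) => /eqP.
have [ilt|ige] := ltnP i b.
  have -> : y`_i = 0 by apply/eqP; apply: contraLR ilt => /minb; rewrite leqNgt.
  by rewrite mul0r.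
have bi : (b < i)%N by rewrite ltn_neqAle ige andbT eq_sym -val_eqE in ib *.
have lt : (b + e - i < e)%N.
  by rewrite ltn_subLR ?ltn_add2r // -ltnS.
rewrite IH ?mulr0 //; apply: leq_trans he; rewrite leq_add2r; exact: ltnW.
Qed.

Let I := ideal_add J K.

(** Induction on [t]. As J I^t is homogeneous, a homogeneous element of degree
    [d] can be tested in degree [d] alone, where only the components of degree
    at most [d] of the cofactor of [y] enter, and these lie in J. *)
Lemma valabrega_valla_descent t :
    (0 < s)%N -> (s <= t)%N ->
    (forall x, J x -> ideal_exp I s x -> ideal_mul J (ideal_exp I s.-1) x) ->
  forall x, J x -> ideal_exp I t x -> ideal_mul J (ideal_exp I t.-1) x.
Proof.
move=> s0 st hs.
have iJ := lines_ideal J_lines; have iK := K_homog.1.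
have hI : homog_ideal I.
  by apply: homog_ideal_add => //; exact: lines_homog_ideal.
have iI := hI.1.
have JI x : J x -> I x by exact: ideal_addl.
have KI x : K x -> I x by exact: ideal_addr.
have [y [Ky y_nz y_red]] := exists_local_reduction.
have Iy := KI _ Ky.
have iIt u := ideal_exp_ideal I u.
have iJI u := ideal_mul_ideal J (ideal_exp I u).
have JIsub u x : ideal_mul J (ideal_exp I u) x -> J x.
  by move: x; apply: ideal_mul_min => // a b Ja _; rewrite mulrC; exact: idealM.
have redN := exp_sub_reduction_iter (l := l) iJ iK Ky s0 y_red hs.
elim: t st => [|t IH]; first by rewrite leqn0 => /eqP s00; rewrite s00 in s0.
rewrite leq_eqVlt => /predU1P[<-//|]; rewrite ltnS => st.
have t0 : (0 < t)%N by exact: leq_trans st.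
have homJI : homog_ideal (ideal_mul J (ideal_exp I t)).
  apply: homog_ideal_mul; first exact: lines_homog_ideal.
  exact: homog_ideal_exp.
suff main d x : x \is d.-homog -> J x -> ideal_exp I t.+1 x ->
    ideal_mul J (ideal_exp I t) x.
  move=> x Jx Ix; rewrite [x]spread_sum; apply: ideal_sum => // d _ /=.
  apply: (main d); first exact: spread_coef_homog.
    exact: lines_homog_ideal.2.
  exact: (homog_ideal_exp t.+1 hI).2.
move=> hx Jx Ix.
(* Large enough for division by [y] on a line to leave order more than [d]. *)
pose N := (d.+1 + \max_i size (line (v i) y))%N.
have [z [w [j [Iz Iw Jj xE]]]] := redN N t.+1 (leqW st) x Ix.
have Jz e : (e <= d)%N -> J (spread z)`_e.
  move=> ed; apply/J_lines => i.
  rewrite (line_homog _ (spread_coef_homog e z)) -coef_line.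
  rewrite (_ : (line (v i) z)`_e = 0) ?mul0r //.
  have [/y_nz Ki0|yi] := eqVneq (line (v i) y) 0.
    suff -> : line (v i) z = 0 by rewrite coef0.
    have : I z by exact: ideal_exp_sub Iz.
    case=> [a [b [/J_lines Ja /Ki0 Kb ->]]].
    by rewrite raddfD /= Ja Kb addr0.
  apply: (@coef_eq0_cofactor _ _ (- line (v i) w) N _ yi).
    have /J_lines/(_ i) := Jx; have /JIsub/J_lines/(_ i) := Jj.
    rewrite xE !raddfD /= !rmorphM rmorphXn /= (line_form l_homog l_v) => ->.
    by rewrite addr0 mulrN => /eqP; rewrite addr_eq0 => /eqP.
  rewrite /N leq_add //; first exact: leqW.
  exact: (leq_bigmax (F := fun i => size (line (v i) y))).
(* Compare the components of degree [d]. *)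
have -> : x = (spread (y * z + l ^+ N * w + j))`_d.
  by rewrite -xE (spread_homog hx) coefMXn ltnn subnn coefC.
rewrite !raddfD /= !coefD; apply: idealD => //; last exact: homJI.2.
rewrite !rmorphM rmorphXn /= (spread_homog l_homog) expr1 exprMn -mulrA.
rewrite mulrCA coefXnM ifT ?addr0; last by rewrite /N ltn_addr.
rewrite coefM; apply: ideal_sum => // i _.
rewrite -(prednK t0); apply: ideal_mul_expS; first exact: hI.2.
apply: IH => //; first by apply: Jz; rewrite leq_subr.
exact: (homog_ideal_exp t hI).2.
Qed.

End Descent.

(** * Lines over a finite set of points *)

Section Geometry.
Variables (k : fieldType) (char0 : [pchar k] =i pred0).

Lemma meval_homogZ n d (f : {mpoly k[n]}) (c : k) (w : 'I_n -> k) :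
  f \is d.-homog -> f.@[fun i => c * w i] = c ^+ d * f.@[w].
Proof.
move=> /dhomogP hf; rewrite !mevalE mulr_sumr; apply: eq_big_seq => m /hf <-.
under eq_bigr do rewrite exprMn.
by rewrite big_split /= prodrXr -mdegE mulrCA.
Qed.

(** Linear forms on the moment curve: infinitely many of them generate all
    variables, so only finitely many can vanish at a given nonzero vector. *)
Lemma exists_separating_form n s (w : 'I_s -> 'I_n -> k) :
    (forall i, exists j, w i j != 0) ->
  exists2 l : {mpoly k[n]}, l \is 1.-homog & forall i, l.@[w i] != 0.
Proof.
move=> w0.
pose X j : {mpoly k[n]} := 'X_j.
have genX : generating_family (ideal_gen (fun f => exists j, f = X j))
    (moment_curve X).
  apply: moment_curve_generating => //; first exact: ideal_gen_ideal.
    by move=> j; apply: mem_ideal_gen; exists j.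
  by move=> A iA AX; apply: ideal_gen_min => // _ [j ->].
have X1 j : X j \is 1.-homog by rewrite dhomogX /= mdeg1.
have l1 c : moment_curve X c \is 1.-homog.
  by apply: rpred_sum => j _; rewrite dhomogZ.
have [b hb] : eventually (fun c => forall i, (moment_curve X c).@[w i] != 0).
  apply: eventually_all => i; apply: NNPP => /not_eventually inf.
  have [j] := w0 i; apply/negP/negPn/eqP.
  have : line (w i) (X j) = 0.
    apply: (genX.2 _ (fun x => line (w i) x = 0) inf).
    - exact: line_ker_ideal.
    - move=> c /negP/negPn/eqP cw.
      by rewrite (line_homog _ (l1 c)) cw mul0r.
    - by apply: mem_ideal_gen; exists j.
  rewrite (line_homog _ (X1 j)) mevalXU => /(congr1 (fun p : {poly k} => p`_1)).
  by rewrite coefMXn /= coefC coef0.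
by exists (moment_curve X b) => // i; apply: hb.
Qed.

Variable n : nat.

Lemma proj_space_vline (P : proj_space k n) :
  val P = <[vpick (val P)]>%VS /\ vpick (val P) != 0.
Proof.
have dP : \dim (val P) = 1%N by apply/eqP; exact: valP P.
have P0 : vpick (val P) != 0.
  by rewrite vpick0; apply/eqP => P0; rewrite P0 dimv0 in dP.
split=> //; apply/eqP; rewrite eq_sym eqEdim -memvE memv_pick dP dim_vline.
by rewrite P0.
Qed.

(** Choosing the vector on each line where [l] is 1 makes [l] restrict to the
    variable x on all lines at once. *)
Lemma exists_normalized_lines (X : {fset proj_space k n}) :
  exists (v : 'I_(#|` X|) -> 'I_n.+1 -> k) (l : {mpoly k[n.+1]}),
    [/\ l \is 1.-homog, forall i, l.@[v i] = 1
      & forall f, defining_ideal X f <-> forall i, line (v i) f = 0].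
Proof.
pose pt := tnth (in_tuple (enum_fset X)).
pose w i : 'rV[k]_n.+1 := vpick (val (pt i)).
have [|l l1 lw] := @exists_separating_form n.+1 _ (fun i => w i ord0).
  move=> i; apply/existsP; apply: contraTT isT.
  rewrite negb_exists => /forallP wi.
  have [_ /eqP[]] := proj_space_vline (pt i).
  by apply/rowP => j; rewrite mxE; apply/eqP/negPn.
pose c i := (l.@[w i ord0])^-1.
pose v i : 'I_n.+1 -> k := fun j => c i * w i ord0 j.
exists v, l; split=> // [i|f].
  by rewrite (meval_homogZ _ _ l1) expr1 mulVf.
split=> [Jf i|fv].
  move: f Jf; apply: ideal_gen_min; first exact: line_ker_ideal.
  move=> f [[d fd] fX] /=; rewrite (line_homog _ fd).
  have Xi : pt i \in X by exact: mem_tnth.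
  have wi : w i \in val (pt i) by exact: memv_pick.
  by rewrite (meval_homogZ _ _ fd) (fX _ Xi _ wi) mulr0 mul0r.
rewrite [f]spread_sum; apply: ideal_sum => [|d _]; first exact: ideal_gen_ideal.
apply: mem_ideal_gen; split; first by exists d; exact: spread_coef_homog.
move=> P PX u uP.
have [i Pi] : exists i, P = pt i by apply/tnthP.
have [uw _] := proj_space_vline P.
have /vlineP [a uE] : u \in <[w i]>%VS by rewrite /w -Pi -uw.
have hd := spread_coef_homog d f.
have cn0 : c i != 0 by rewrite invr_eq0.
have -> : ((spread f)`_d).@[u ord0] =
    ((spread f)`_d).@[fun j => a / c i * v i j].
  by apply: meval_eq => j; rewrite uE mxE /v mulrA divfK.
by rewrite (meval_homogZ _ _ hd) -coef_line fv coef0 mulr0.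
Qed.

End Geometry.

(** * Ideals of minors *)

Section Minors.

Lemma minors_ideal_fg (R : comNzRingType) p q r (M : 'M[R]_(p, q)) :
  exists (N : nat) (h : 'I_N -> R), (forall i, minors_ideal r M (h i)) /\
    forall A, is_ideal A -> (forall i, A (h i)) ->
      forall x, minors_ideal r M x -> A x.
Proof.
pose T := ({ffun 'I_r -> 'I_p} * {ffun 'I_r -> 'I_q})%type.
pose mono N (f : {ffun 'I_r -> 'I_N}) :=
  [forall i : 'I_r, forall j : 'I_r, (i < j)%N ==> (f i < f j)%N].
have monoP N (f : {ffun 'I_r -> 'I_N}) :
    reflect {homo f : i j / (i < j)%N} (mono N f).
  apply: (iffP forallP) => [h i j ij|h i].
    by have /forallP/(_ j)/implyP := h i; apply.
  by apply/forallP => j; apply/implyP; exact: h.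
(* Zero at the pairs that define no minor, to index by a whole finite type. *)
pose g (t : T) :=
  if mono _ t.1 && mono _ t.2 then \det (mxsub t.1 t.2 M) else 0.
exists #|{: T}|, (fun i => g (enum_val i)); split=> [i|A iA Ag].
  rewrite /g; case: andP => [[/monoP f1 /monoP f2]|_].
    by apply: mem_ideal_gen; exists (enum_val i).1, (enum_val i).2.
  exact: ideal0 (ideal_gen_ideal _).
apply: ideal_gen_min => // _ [f1 [f2 [h1 h2 ->]]].
have := Ag (enum_rank ([ffun i => f1 i], [ffun i => f2 i])).
rewrite enum_rankK /g /= ifT; last first.
  by apply/andP; split; apply/monoP => i j ij; rewrite !ffunE; auto.
congr (A (\det _)); apply/matrixP => i j.
by rewrite !mxE !ffunE.
Qed.

Variables (k : fieldType).

Lemma dhomog_mderiv m d (f : {mpoly k[m]}) i :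
  f \is d.-homog -> f^`M(i) \is d.-1.-homog.
Proof.
move=> /dhomogP hf; rewrite (mpolyE f) raddf_sum big_seq.
apply: rpred_sum => e /hf de; rewrite /= mderivZ mderivX dhomogZ //.
have [->|ei] := eqVneq (e i) 0%N; first by rewrite scale0r dhomog0.
rewrite dhomogZ // dhomogX /=; apply/eqP.
have ie : (U_(i) <= e)%MM by rewrite lep1mP.
have := mdegD (e - U_(i)) U_(i); rewrite (submK ie) mdeg1 addn1.
by move=> /(congr1 predn) /= <-; rewrite -de.
Qed.

Lemma dhomog_bigprod m r (d : 'I_r -> nat) (g : 'I_r -> {mpoly k[m]}) :
  (forall i, g i \is (d i).-homog) -> \prod_i g i \is (\sum_i d i).-homog.
Proof.
move=> hg; elim/big_rec2: _ => [|i p e _ he]; first exact: dhomog1.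
exact: dhomogM.
Qed.

(** If the entries of each row are homogeneous of a common degree, so are the
    products in the expansion of a minor. *)
Lemma homog_minors_ideal m p q r (d : 'I_p -> nat)
    (M : 'M[{mpoly k[m]}]_(p, q)) :
  (forall i j, M i j \is (d i).-homog) -> homog_ideal (minors_ideal r M).
Proof.
move=> hM; apply: homog_ideal_gen => _ [f [g [_ _ ->]]].
exists (\sum_i d (f i))%N; rewrite /determinant; apply: rpred_sum => u _.
rewrite rpredMsign; apply: dhomog_bigprod => i.
by rewrite mxE.
Qed.

End Minors.

(** * The theorem *)

Theorem proposition1p3 (k : closedFieldType) (char0 : [pchar k] =i pred0)
    (n s : nat) (n_ge2 : (2 <= n)%N)
    (X : {fset proj_space k n}) (cardX : #|` X| = s)
    (m : nat) (F : 'I_m -> {mpoly k[n.+1]})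
    (F_gen : homogeneous_generators F (defining_ideal X)) :
  let J := defining_ideal X in
  let I := jacobian_ideal J F in
  (forall t : nat, (2 <= t <= s)%N ->
     ideal_eq (ideal_cap J (ideal_exp I t)) (ideal_mul J (ideal_exp I t.-1))) ->
  VV_torsion_free J I.
Proof.
move=> J I hyp t t2; rewrite -cardX in hyp.
have [v [l [l1 lv J_lines]]] := exists_normalized_lines char0 X.
have iJ := lines_ideal J_lines.
have [d Fd] := fin_all_exists F_gen.1.
have K_homog : homog_ideal (minors_ideal n (jacobian_matrix F)).
  apply: (@homog_minors_ideal _ _ _ _ _ (fun i => (d i).-1)) => i j.
  by rewrite mxE; exact: dhomog_mderiv.
have [N [h [Kh K_min]]] := minors_ideal_fg n (jacobian_matrix F).
have JI x : J x -> I x by apply: ideal_addl; exact: K_homog.1.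
move=> x; split=> [[Jx Ix]|JIx]; last first.
  split; move: x JIx; apply: ideal_mul_min => //.
  - by move=> a b Ja _; rewrite mulrC; exact: idealM.
  - exact: ideal_exp_ideal.
  - move=> a b /JI Ia Ib; apply: ideal_expS_pred => //.
have [ts|st] := leqP t #|` X|.
  by apply: (hyp t _ x).1 => //; rewrite t2.
(* Without points, J is the unit ideal. *)
case: (posnP #|` X|) => [X0|s0].
  case: t t2 {st} Ix => [//|t] _; apply: ideal_mul_min.
    exact: ideal_mul_ideal.
  move=> a b _ Ib; apply: mem_ideal_mul => //; apply/J_lines => i.
  by have := leq_ltn_trans (leq0n i) (ltn_ord i); rewrite X0.
apply: (valabrega_valla_descent char0 l1 lv J_lines K_homog Kh K_min s0
  (ltnW st)) => //.
(* For a single point the equality needed is J = J I^0. *)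
move=> {Jx Ix}x Jx Ix; have [s1|s2] := leqP #|` X| 1.
  have -> : #|` X|.-1 = 0%N by case: #|` X| s1 => [|[]].
  by rewrite -[x]mulr1; apply: mem_ideal_mul.
by apply: (hyp _ _ x).1 => //; rewrite s2 leqnn.
Qed.
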